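(* Let $q_1,q_0\geq 2$ be integers, $\mathbb{F}=\{1,-1\}$, and let $A\in M_{q_1}(\mathbb{F})$ and $B\in M_{q_0}(\mathbb{F})$. For $m\in\{0,1,\ldots,q_0-1\}$ let $p_m=\frac12|B_{0,m}-B_{q_0-1,m}|$. Let $k=k_1q_0+k_0$ with $k_1\in\{0,1,\ldots,q_1-1\}$ and $k_0\in\{0,1,\ldots,q_0-1\}$. Let $\mathcal{S}_k$ denote the sequency of the $k$-th column of $A\otimes B$, let $\mathcal{S}_{k_0}$ denote the sequency of the $k_0$-th column of $B$, and let $\mathcal{S}_{k_1}$ denote the sequency of the $k_1$-th column of $A$. Then $$\mathcal{S}_k=q_1\,\mathcal{S}_{k_0}+(q_1-1)\,p_{k_0}+(-1)^{p_{k_0}}\,\mathcal{S}_{k_1}.$$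
   Context: $M_q(\mathbb{F})$ is the set of $q\times q$ matrices with entries in $\mathbb{F}=\{1,-1\}$; rows and columns are indexed starting from $0$. The sequency of $v=[v_0\ v_1\ \cdots\ v_{N-1}]^T\in\mathbb{F}^N$ is $\mathcal{S}_v=\frac12\sum_{k=0}^{N-2}|v_k-v_{k+1}|$ (the number of sign changes). $\otimes$ is the Kronecker product: $(A\otimes B)_{q_0i_1+i_0,\;q_0k_1+k_0}=A_{i_1,k_1}B_{i_0,k_0}$ for $i_1,k_1\in\{0,\ldots,q_1-1\}$ and $i_0,k_0\in\{0,\ldots,q_0-1\}$. *)

(* Defs.v *)
From mathcomp Require Import all_boot all_order all_algebra.
From mathcomp.real_closed Require Export mxtens.

Set Implicit Arguments.
Unset Strict Implicit.
Unset Printing Implicit Defensive.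

Import Order.TTheory GRing.Theory Num.Theory.
Local Open Scope ring_scope.

(* The Kronecker product is [tensmx] of mxtens, for which
     tensmx A B (mxtens_index (i1, i0)) (mxtens_index (k1, k0))
       = A i1 k1 * B i0 k0
   with mxtens_index (i1, i0) = q0 * i1 + i0 :> nat (lemma tensmxE). *)

Definition pm1 : {pred rat} := pred2 1 (-1).

Section Indices.
Variable N : nat.

Lemma cur_subproof (k : 'I_N.-1) : (k < N)%N.
Proof. exact: leq_trans (ltn_ord k) (leq_pred N). Qed.

Lemma next_subproof (k : 'I_N.-1) : (k.+1 < N)%N.
Proof. by rewrite -ltn_predRL. Qed.

Definition cur_idx (k : 'I_N.-1) : 'I_N := Ordinal (cur_subproof k).
Definition next_idx (k : 'I_N.-1) : 'I_N := Ordinal (next_subproof k).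

Lemma last_subproof : (2 <= N)%N -> (N.-1 < N)%N.
Proof. by move=> hN; rewrite ltn_predL ltnW. Qed.

Definition first_idx (hN : (2 <= N)%N) : 'I_N := Ordinal (ltnW hN).
Definition last_idx (hN : (2 <= N)%N) : 'I_N := Ordinal (last_subproof hN).

Definition sequency (v : 'cV[rat]_N) : rat :=
  2^-1 * \sum_(k < N.-1) `|v (cur_idx k) 0 - v (next_idx k) 0|.

Definition end_change (hN : (2 <= N)%N) (B : 'M[rat]_N) (m : 'I_N) : rat :=
  2^-1 * `|B (first_idx hN) m - B (last_idx hN) m|.

(* A power in a ring needs an exponent in nat: by the next lemma, for a
   matrix with entries in {1, -1}, [Num.truncn] only retypes [end_change]. *)
Lemma truncn_end_change (hN : (2 <= N)%N) (B : 'M[rat]_N) (m : 'I_N) :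
  B \is a mxOver pm1 ->
  (Num.truncn (end_change hN B m))%:R = end_change hN B m.
Proof.
move=> /mxOverP hB; rewrite /end_change.
have := hB (first_idx hN) m; have := hB (last_idx hN) m.
by rewrite !inE => /orP[] /eqP-> /orP[] /eqP->.
Qed.

End Indices.

(* Main.v *)
Require Import Defs.
From mathcomp Require Import all_boot all_order all_algebra.
From mathcomp Require Import zify.
Import Order.TTheory GRing.Theory Num.Theory.
Local Open Scope ring_scope.

(** Entry [j * q0 + i] of the column of the Kronecker product is [a j * b i],
    where [a] and [b] are the columns of [A] and [B]: the column consists of
    [q1] consecutive copies of [b], each multiplied by a sign.  Its consecutive
    pairs are of two kinds ([sum_blocks]).  Those inside a copy are the pairs of
    [b], and a global sign does not affect a change, so they contribute [q1]
    times the sequency of [b].  The [q1 - 1] pairs at a junction compare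
    [a j] times the last entry of [b] with [a (j + 1)] times its first entry.
    If the two ends of [b] agree, the sign changes there exactly when [a]
    changes; if they differ, exactly when [a] does not.  So a junction
    contributes [p + (-1) ^ p * s], where [s] is 0 or 1 according to whether
    [a] changes ([junction_change]), and summing over the junctions gives the
    remaining two terms. *)

(** Passing from a column to a function on the naturals allows its indices to
    be split as [j * q + i] without casts between ordinal types. *)
Lemma sequency_nat {N : nat} {v : 'cV[rat]_N} {f : nat -> rat} :
  (forall i : 'I_N, v i 0 = f i) ->
  sequency v = 2^-1 * \sum_(k < N.-1) `|f k - f k.+1|.
Proof.
by move=> vf; congr (_ * _); apply: eq_bigr => k _; rewrite !vf.
Qed.

(** The [m * q] points of [m] consecutive blocks of length [q] have
    [m * q - 1] consecutive pairs, indexed by their left point: [q - 1] pairs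
    inside each block and one pair at each of the [m - 1] junctions. *)
Lemma sum_blocks {V : nmodType} {m q : nat} (F : nat -> V) :
  (0 < m)%N -> (0 < q)%N ->
  \sum_(i < (m * q).-1) F i =
    \sum_(j < m) \sum_(i < q.-1) F (j * q + i)%N
    + \sum_(j < m.-1) F (j * q + q.-1)%N.
Proof.
case: m q => [|m] [|q] // _ _; elim: m => [|m IHm].
  by rewrite mul1n /= big_ord1 big_ord0 addr0.
(* Block [m.+1] adds one junction pair, then the [q] pairs inside it. *)
have -> : (m.+2 * q.+1).-1 = ((m.+1 * q.+1).-1.+1 + q)%N by lia.
rewrite big_split_ord big_ord_recr IHm -[m.+2.-1]/m.+1.
rewrite [in RHS]big_ord_recr [X in _ = _ + X]big_ord_recr -[q.+1.-1]/q.
have -> : (m * q.+1 + q)%N = (m.+1 * q.+1).-1 by lia.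
rewrite -[LHS]addrA [X in _ + X = _]addrC [RHS]addrACA.
(* What remains holds by conversion: [(m.+1 * q.+1).-1.+1] computes to
   [m.+1 * q.+1], since the latter is a successor. *)
by [].
Qed.

Lemma pm1P (x : rat) : x \in pm1 -> x = 1 \/ x = -1.
Proof. by rewrite !inE => /orP[] /eqP->; [left|right]. Qed.

Lemma norm_pm1 (x : rat) : x \in pm1 -> `|x| = 1.
Proof. by case/pm1P=> ->. Qed.

(** When [b0 = - bl], the change across the junction is [`|x + y|], which for
    signs is [2 - `|x - y|]: this is where the sign [(-1) ^ p] comes from.
    When [b0 = bl], it is [`|x - y|] itself. *)
Lemma junction_change (x y b0 bl : rat) (p := 2^-1 * `|b0 - bl|) :
  x \in pm1 -> y \in pm1 -> b0 \in pm1 -> bl \in pm1 ->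
  `|x * bl - y * b0| = 2 * p + (-1) ^+ Num.truncn p * `|x - y|.
Proof.
(* Each of the sixteen sign patterns is settled by computation. *)
rewrite /p => /pm1P[] -> /pm1P[] -> /pm1P[] -> /pm1P[] ->.
all: by apply/eqP; vm_compute.
Qed.

Theorem lemma3p4 (q1 q0 : nat) (hq1 : (2 <= q1)%N) (hq0 : (2 <= q0)%N)
    (A : 'M[rat]_q1) (B : 'M[rat]_q0)
    (hA : A \is a mxOver pm1) (hB : B \is a mxOver pm1)
    (k1 : 'I_q1) (k0 : 'I_q0) (k : 'I_(q1 * q0))
    (hk : nat_of_ord k = (k1 * q0 + k0)%N) :
  sequency (col k (tensmx A B)) =
    q1%:R * sequency (col k0 B)
    + (q1%:R - 1) * end_change hq0 B k0
    + (-1) ^+ Num.truncn (end_change hq0 B k0) * sequency (col k1 A).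
Proof.
have q1_gt0 := ltnW hq1; have q0_gt0 := ltnW hq0.
(* Out of range, [insubd] falls back on an actual row, so that [a] and [b]
   take values in {1, -1} at every natural number. *)
pose a i := A (insubd k1 i) k1; pose b i := B (insubd k0 i) k0.
have a_pm1 i : a i \in pm1 by apply: (mxOverP hA).
have b_pm1 i : b i \in pm1 by apply: (mxOverP hB).
have aE (i : 'I_q1) : col k1 A i 0 = a i by rewrite mxE /a valKd.
have bE (i : 'I_q0) : col k0 B i 0 = b i by rewrite mxE /b valKd.
have -> : k = mxtens_index (k1, k0).
  by apply: val_inj; rewrite /= hk; lia.
pose c i := a (i %/ q0)%N * b (i %% q0)%N.
have c_block j i : (i < q0)%N -> c (j * q0 + i)%N = a j * b i.
  by move=> lti; rewrite /c divnMDl // divn_small // addn0 modnMDl modn_small.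
have cE (i : 'I_(q1 * q0)) :
    col (mxtens_index (k1, k0)) (tensmx A B) i 0 = c i.
  case: (mxtens_indexP i) => i1 i0.
  by rewrite mxE tensmxE c_block // -aE -bE !mxE.
rewrite (sequency_nat cE) (sequency_nat aE) (sequency_nat bE).
have -> : end_change hq0 B k0 = 2^-1 * `|b 0%N - b q0.-1|.
  rewrite /end_change -[b 0%N](bE (first_idx hq0)).
  by rewrite -[b q0.-1](bE (last_idx hq0)) !mxE.
set p := 2^-1 * `|b 0%N - _|.
rewrite [X in 2^-1 * X = _](sum_blocks (fun i => `|c i - c i.+1|)) //.
under eq_bigr => j _.
  under eq_bigr => i _.
    have lti : (i.+1 < q0)%N by rewrite -ltn_predRL.
    rewrite -addnS !c_block ?(ltnW lti) // -mulrBr normrM norm_pm1 // mul1r.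
    over.
  over.
rewrite sumr_const card_ord.
under [X in _ * (_ + X)]eq_bigr => j _.
  have -> : (j * q0 + q0.-1).+1 = (j.+1 * q0 + 0)%N by lia.
  rewrite !c_block ?ltn_predL // junction_change // -/p.
  over.
rewrite big_split /= sumr_const card_ord -mulr_sumr.
rewrite -[_ *+ q1]mulr_natl -[_ *+ q1.-1]mulr_natl.
have -> : q1.-1%:R = q1%:R - 1 :> rat by rewrite -subn1 natrB.
by rewrite !mulrDr !(mulrCA 2^-1) mulVKf // addrA.
Qed.
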